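(* Let $R$ be a $U\sqrt{\Delta}$-ring. Then: (1) $R$ has no non-trivial central idempotent (i.e. the only central idempotents are $0$ and $1$). In particular, $R$ is an indecomposable ring. (2) $R$ is Dedekind-finite (i.e. for all $a,b\in R$, $ab=1$ implies $ba=1$).
   Context: All rings are associative with identity. For a ring $R$, $U(R)$ is its group of units, $\Delta(R)=\{x\in R \mid x+u\in U(R)\text{ for all }u\in U(R)\}$, and $\sqrt{\Delta(R)}=\{x\in R\mid x^n\in\Delta(R)\text{ for some integer }n\ge 1\}$. A ring $R$ is a $U\sqrt{\Delta}$-ring if every non-unit $a\in R$ can be written as $a=ub$ with $u\in U(R)$ and $b\in\sqrt{\Delta(R)}$. A ring is indecomposable if it is not isomorphic to a direct product of two nonzero rings. *)

(* Defs.v *)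
From HB Require Import structures.
From mathcomp Require Import all_boot all_order all_algebra.

Set Implicit Arguments.
Unset Strict Implicit.
Unset Printing Implicit Defensive.

Import GRing.Theory.
Local Open Scope ring_scope.

(* Rings are pzRingType: associative and unital, possibly noncommutative and  *)
(* possibly zero. GRing.unit is not used because it needs a unitRingType,     *)
(* which is nonzero and comes with a boolean test for units.                  *)
Definition is_unit (R : pzRingType) (x : R) : Prop :=
  exists y : R, x * y = 1 /\ y * x = 1.

Definition in_Delta (R : pzRingType) (x : R) : Prop :=
  forall u : R, is_unit u -> is_unit (x + u).

Definition in_sqrtDelta (R : pzRingType) (x : R) : Prop :=
  exists n : nat, (1 <= n)%N /\ in_Delta (x ^+ n).

Definition UsqrtDelta_ring (R : pzRingType) : Prop :=
  forall a : R, ~ is_unit a ->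
    exists u b : R, [/\ is_unit u, in_sqrtDelta b & a = u * b].

Definition idempotent_elt (R : pzRingType) (e : R) : Prop := e * e = e.

Definition central_elt (R : pzRingType) (e : R) : Prop :=
  forall x : R, GRing.comm e x.

(* The factors are nonzero because nzRingType requires 1 != 0. The zero ring  *)
(* is indecomposable with this definition.                                    *)
Definition indecomposable_ring (R : pzRingType) : Prop :=
  ~ exists (R1 R2 : nzRingType) (f : {rmorphism R -> (R1 * R2)%type}),
      bijective f.

Definition Dedekind_finite (R : pzRingType) : Prop :=
  forall a b : R, a * b = 1 -> b * a = 1.

(* Main.v *)
Require Import Defs.
From mathcomp Require Import all_boot all_order all_algebra.

Import GRing.Theory.
Local Open Scope ring_scope.

(** Both halves reduce to one fact: [Delta(R)] contains no nonzero idempotent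
    ([Delta_idempotent_eq0]), because [1 - e] is then a unit as well as an
    idempotent, hence equal to [1].

    If [e] is a central idempotent other than [1], it is a non-unit, so
    [e = u * b] with [b ^+ n] in [Delta(R)].  As [e] is central,
    [b ^+ n = u^-1 ^+ n * e], and [Delta(R)] absorbs units on both sides, so [e]
    itself lies in [Delta(R)] and vanishes.  A decomposition of [R] as a
    product would yield the non-trivial central idempotent [(1, 0)].

    For Dedekind-finiteness let [a * b = 1].  If [a] is a non-unit, write
    [a = u * c] with [c ^+ n] in [Delta(R)]; then [c ^+ n] has a right inverse.
    The key point is [Delta_right_inverse]: if [x] is in [Delta(R)] and
    [x * y = 1], the idempotent [f = 1 - y * x] satisfies [f * y = 0], so
    [y * f] squares to zero.  An element [z] of square zero is the difference
    [(1 + z) - 1] of two units, so [Delta(R)] absorbs it, and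
    [f = x * (y * f)] is an idempotent of [Delta(R)], that is, [f = 0].  Thus
    [x] is a unit in [Delta(R)], which makes [0 = x + (- x)] a unit and [R] the
    zero ring. *)

Section Delta.

Variable R : pzRingType.
Implicit Types a b e u v x y z : R.

Lemma is_unit1 : is_unit (1 : R).
Proof. by exists 1; rewrite mulr1. Qed.

Lemma is_unitN u : is_unit u -> is_unit (- u).
Proof. by case=> v [uv vu]; exists (- v); rewrite !mulrNN. Qed.

Lemma is_unitM u v : is_unit u -> is_unit v -> is_unit (u * v).
Proof.
move=> [u' [uu' u'u]] [v' [vv' v'v]]; exists (v' * u'); split.
  by rewrite mulrA -(mulrA u) vv' mulr1.
by rewrite mulrA -(mulrA v') u'u mulr1.
Qed.

Lemma is_unitX u n : is_unit u -> is_unit (u ^+ n).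
Proof.
move=> Uu; elim: n => [|n IHn]; first by rewrite expr0; apply: is_unit1.
by rewrite exprS; apply: is_unitM.
Qed.

Lemma is_unit_1Dsqr0 z : z * z = 0 -> is_unit (1 + z).
Proof.
move=> zz0; exists (1 - z); split.
  by rewrite mulrBr mulr1 mulrDl mul1r zz0 addr0 addrK.
by rewrite mulrBl mul1r mulrDr mulr1 zz0 addr0 addrK.
Qed.

Lemma is_unit_idempotent e : is_unit e -> idempotent_elt e -> e = 1.
Proof.
by move=> [v [ev _]] ee; rewrite -[LHS]mulr1 -ev mulrA (ee : e * e = e).
Qed.

Lemma idempotent_subr1 e : idempotent_elt e -> idempotent_elt (1 - e).
Proof.
move=> ee; rewrite /idempotent_elt mulrBr mulr1 mulrBl mul1r.
by rewrite (ee : e * e = e) subrr subr0.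
Qed.

Lemma right_inverseX x y n : x * y = 1 -> x ^+ n * y ^+ n = 1.
Proof.
move=> xy1; elim: n => [|n IHn]; first by rewrite !expr0 mulr1.
by rewrite exprSr exprS mulrA -(mulrA _ x) xy1 mulr1.
Qed.

Lemma DeltaB x y : in_Delta x -> in_Delta y -> in_Delta (x - y).
Proof.
move=> Dx Dy u Uu; rewrite -addrA; apply: Dx.
have -> : - y + u = - (y - u) by rewrite opprB addrC.
exact/is_unitN/Dy/is_unitN.
Qed.

(** [u * x + v] is a unit because [u * x + v = u * (x + u^-1 * v)]. *)
Lemma Delta_unitMl u x : is_unit u -> in_Delta x -> in_Delta (u * x).
Proof.
move=> Uu Dx v Uv; have [u' [uu' u'u]] := Uu.
have -> : u * x + v = u * (x + u' * v) by rewrite mulrDr mulrA uu' mul1r.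
by apply/is_unitM/Dx/is_unitM => //; exists u.
Qed.

Lemma Delta_unitMr u x : is_unit u -> in_Delta x -> in_Delta (x * u).
Proof.
move=> Uu Dx v Uv; have [u' [uu' u'u]] := Uu.
have -> : x * u + v = (x + v * u') * u by rewrite mulrDl -mulrA u'u mulr1.
by apply: is_unitM => //; apply: Dx; apply: is_unitM => //; exists u.
Qed.

(** Square-zero elements are differences of two units, namely
    [z = (1 + z) - 1]. *)
Lemma Delta_sqr0Mr x z : in_Delta x -> z * z = 0 -> in_Delta (x * z).
Proof.
move=> Dx zz0.
have -> : x * z = x * (1 + z) - x by rewrite mulrDr mulr1 addrC addKr.
by apply: DeltaB => //; apply: Delta_unitMr => //; apply: is_unit_1Dsqr0.
Qed.

(** The unit [e - 1] makes [1 - e] a unit idempotent. *)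
Lemma Delta_idempotent_eq0 e : in_Delta e -> idempotent_elt e -> e = 0.
Proof.
move=> De ee.
have U1e : is_unit (1 - e).
  by rewrite -opprB; apply/is_unitN/De/is_unitN/is_unit1.
have e1 := is_unit_idempotent _ U1e (idempotent_subr1 _ ee).
by rewrite -(subKr 1 e) e1 subrr.
Qed.

Lemma Delta_unit_trivial x : in_Delta x -> is_unit x -> 1 = 0 :> R.
Proof.
move=> Dx /is_unitN/Dx; rewrite subrr => -[v [v0 _]].
by rewrite -v0 mul0r.
Qed.

(** The defect [f = 1 - y * x] is [x * (y * f)] with [y * f] of square zero, so
    [Delta_sqr0Mr] puts this idempotent in [Delta(R)]. *)
Lemma Delta_right_inverse x y : in_Delta x -> x * y = 1 -> y * x = 1.
Proof.
move=> Dx xy1; set f := 1 - y * x.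
have fy0 : f * y = 0 by rewrite mulrBl mul1r -mulrA xy1 mulr1 subrr.
have ff : idempotent_elt f.
  by apply: idempotent_subr1; rewrite /idempotent_elt mulrA -(mulrA y) xy1 mulr1.
have yf_sqr0 : (y * f) * (y * f) = 0.
  by rewrite -mulrA (mulrA f) fy0 mul0r mulr0.
have Df : in_Delta f.
  by rewrite -[f]mul1r -xy1 -mulrA; apply: Delta_sqr0Mr.
have /eqP := Delta_idempotent_eq0 _ Df ff.
by rewrite subr_eq0 eq_sym => /eqP.
Qed.

Lemma UsqrtDelta_central_idempotent e : UsqrtDelta_ring R ->
  central_elt e -> idempotent_elt e -> e = 0 \/ e = 1.
Proof.
move=> hR Ce ee; have [->|/eqP e_neq1] := eqVneq e 1; [by right | left].
have nUe : ~ is_unit e by move/is_unit_idempotent/(_ ee).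
have [u [b [Uu [n [n_gt0 Dbn]] e_ub]]] := hR e nUe.
have [u' [uu' u'u]] := Uu.
have b_u'e : b = u' * e by rewrite e_ub mulrA u'u mul1r.
have en : e ^+ n = e.
  case: n n_gt0 {Dbn} => // n _; elim: n => [|n IHn]; first by rewrite expr1.
  by rewrite exprS IHn.
apply: Delta_idempotent_eq0 => //.
have -> : e = u ^+ n * b ^+ n.
  rewrite b_u'e exprMn_comm; last by apply/commr_sym/Ce.
  by rewrite mulrA right_inverseX // mul1r en.
by apply: Delta_unitMl => //; apply: is_unitX.
Qed.

Lemma UsqrtDelta_Dedekind_finite : UsqrtDelta_ring R -> Dedekind_finite R.
Proof.
move=> hR a b ab1; have [//|/eqP ba_neq1] := eqVneq (b * a) 1.
have nUa : ~ is_unit a.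
  move=> [a' [_ a'a]]; apply: ba_neq1.
  by rewrite -a'a -[b]mul1r -a'a -(mulrA a') ab1 mulr1.
have [u [c [[u' [uu' u'u]] [n [_ Dcn]] a_uc]]] := hR a nUa.
have c_inv : c * (b * u) = 1.
  have -> : c = u' * a by rewrite a_uc mulrA u'u mul1r.
  by rewrite mulrA -(mulrA u') ab1 mulr1.
have cn_inv := right_inverseX _ _ n c_inv.
have one0 : 1 = 0 :> R.
  apply: (Delta_unit_trivial _ Dcn); exists ((b * u) ^+ n); split => //.
  exact: Delta_right_inverse.
by rewrite -[b * a]mulr1 one0 mulr0.
Qed.

End Delta.

Lemma indecomposable_central_idempotent (R : pzRingType) :
  (forall e : R, central_elt e -> idempotent_elt e -> e = 0 \/ e = 1) ->
  indecomposable_ring R.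
Proof.
move=> triv [R1 [R2 [f [g fK gK]]]].
pose e := g (1, 0).
have fe : f e = (1, 0) by rewrite gK.
have Ce : central_elt e.
  move=> x; apply: (can_inj fK); rewrite !rmorphM fe.
  case: (f x) => x1 x2.
  by congr pair; rewrite /= ?(mulr1, mul1r, mulr0, mul0r).
have ee : idempotent_elt e.
  apply: (can_inj fK); rewrite rmorphM fe.
  by congr pair; rewrite /= ?(mulr1, mulr0).
case: (triv e Ce ee) => eE; move: fe; rewrite eE.
  by rewrite rmorph0 => -[/eqP]; rewrite eq_sym oner_eq0.
by rewrite rmorph1 => -[/eqP]; rewrite oner_eq0.
Qed.

Theorem proposition2p7 (R : pzRingType) (hR : UsqrtDelta_ring R) :
  ((forall e : R, central_elt e -> idempotent_elt e -> e = 0 \/ e = 1)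
   /\ indecomposable_ring R)
  /\ Dedekind_finite R.
Proof.
have triv (e : R) := UsqrtDelta_central_idempotent _ e hR.
split; last exact: UsqrtDelta_Dedekind_finite.
by split=> //; apply: indecomposable_central_idempotent.
Qed.
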